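(* There exist constants $c_1,c_2>0$ such that for every $n\in\mathbb{N}^*$ and every boolean function $f:\{-1,1\}^n\to\{-1,1\}$, $$Ent(f)\leq c_1I(f)+c_2\sum_{k\in[n]}-I_k(f)\log I_k(f),$$ with the convention $I_k(f)\log I_k(f)=0$ when $I_k(f)=0$.
   Context: $\{-1,1\}^n$ carries the uniform measure. $\hat f(S)=2^{-n}\sum_x f(x)\prod_{i\in S}x_i$ for $S\subseteq[n]$. The spectrum entropy is $Ent(f)=\sum_{S}\hat f(S)^2\log_2\frac{1}{\hat f(S)^2}$ (terms with $\hat f(S)=0$ being $0$). The influence is $I_k(f)=\mathbb{P}_x(f(x)\neq f(\mu_k(x)))$, where $\mu_k(x)$ is $x$ with the $k$-th coordinate flipped, and $I(f)=\sum_{k\in[n]}I_k(f)$. Here $\log$ is the natural logarithm. *)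

(* Defs.v *)
From mathcomp Require Import all_boot all_order all_algebra.
From mathcomp Require Import reals exp.

Set Implicit Arguments.
Unset Strict Implicit.
Unset Printing Implicit Defensive.

Import Order.TTheory GRing.Theory Num.Theory.
Local Open Scope ring_scope.

(* The two-element set {-1, 1} is encoded by bool: b stands for (-1)^b, so that
   false is 1 and true is -1. Both the coordinates of a point of the cube and
   the values of a boolean function are encoded in this way. *)
Definition pm1 (R : realType) (b : bool) : R := (-1) ^+ b.

Definition cube (n : nat) : finType := {ffun 'I_n -> bool}.

(* Negation of the bit changes the sign of the coordinate. *)
Definition flip (n : nat) (k : 'I_n) (x : cube n) : cube n :=
  [ffun i => if i == k then ~~ x i else x i].

(* Probability of an event under the uniform measure on the cube. *)
Definition cube_prob (R : realType) (n : nat) (A : {set cube n}) : R :=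
  #|A|%:R / 2 ^+ n.

Definition fourier (R : realType) (n : nat) (f : cube n -> bool)
    (S : {set 'I_n}) : R :=
  2 ^- n * \sum_(x : cube n) pm1 R (f x) * \prod_(i in S) pm1 R (x i).

Definition log2 (R : realType) (x : R) : R := ln x / ln 2.

(* A vanishing coefficient contributes 0, because of the factor fourier ^+ 2. *)
Definition spectral_entropy (R : realType) (n : nat) (f : cube n -> bool) : R :=
  \sum_(S : {set 'I_n})
    fourier R f S ^+ 2 * log2 (1 / fourier R f S ^+ 2).

Definition influence (R : realType) (n : nat) (f : cube n -> bool)
    (k : 'I_n) : R :=
  cube_prob R [set x | f x != f (flip k x)].

Definition total_influence (R : realType) (n : nat) (f : cube n -> bool) : R :=
  \sum_(k < n) influence R f k.

(* Main.v *)
(* The squares of the Fourier coefficients of f form the law of a random set S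
   with P(k \in S) = I_k(f). By subadditivity of the Shannon entropy, the
   entropy of S is at most the sum of the binary entropies of its indicators
   [k \in S], and - (1 - t) ln (1 - t) <= t. This gives c1 = c2 = 1 / ln 2. *)
Require Import Defs.
From mathcomp Require Import all_boot all_order all_algebra.
From mathcomp Require Import lra.
From mathcomp Require Import reals exp.

Import Order.TTheory GRing.Theory Num.Theory.
Local Open Scope ring_scope.

Lemma ln_le_subr1 {R : realType} (x : R) : 0 < x -> ln x <= x - 1.
Proof. by move=> x0; have := @le_ln1Dx R (x - 1); rewrite subrKC; apply; lra. Qed.

Lemma ln_prod {R : realType} {I : finType} (F : I -> R) :
  (forall i, 0 < F i) -> ln (\prod_i F i) = \sum_i ln (F i).
Proof.
move=> F0; suff [] : 0 < \prod_i F i /\ ln (\prod_i F i) = \sum_i ln (F i) by [].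
elim/big_rec2: _ => [|i y1 y2 _ [y0 <-]]; first by rewrite ln1.
by rewrite mulr_gt0// lnM// posrE.
Qed.

(** Termwise, [ln x <= x - 1] at [x = q i / p i], multiplied by [p i], bounds the difference of the
    two sides by [q i - p i], and these bounds sum to at most 0. *)
Lemma gibbs {R : realType} {I : finType} (p q : I -> R) :
    (forall i, 0 <= p i) -> (forall i, 0 <= q i) ->
    (forall i, 0 < p i -> 0 < q i) -> \sum_i q i <= \sum_i p i ->
  \sum_i p i * ln (1 / p i) <= \sum_i - (p i * ln (q i)).
Proof.
move=> p0 q0 pq qp.
apply: (@le_trans _ _ (\sum_i (- (p i * ln (q i)) + (q i - p i)))); last first.
  by rewrite big_split/= gerDl sumrB subr_le0.
apply: ler_sum => i _.
have := p0 i; rewrite le_eqVlt => /predU1P[<-|pi0].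
  by rewrite !mul0r oppr0 add0r addr0.
have qi0 := pq _ pi0.
have /(ler_wpM2l (ltW pi0)) := ln_le_subr1 _ (divr_gt0 qi0 pi0).
rewrite ln_div ?posrE// !mulrBr mulr1 (mulrCA (p i)) divff ?gt_eqF// mulr1.
rewrite div1r lnV ?posrE//; lra.
Qed.

(** Gibbs' inequality compares [p] with the law under which the events [k \in S] are independent and
    keep their probabilities [t k]. *)
Lemma entropy_subadditive {R : realType} {T : finType} (p : {set T} -> R)
    (t := fun k : T => \sum_(S : {set T} | k \in S) p S) :
    (forall S, 0 <= p S) -> \sum_S p S = 1 ->
  \sum_S p S * ln (1 / p S)
    <= \sum_k - (t k * ln (t k) + (1 - t k) * ln (1 - t k)).
Proof.
move=> p0 p1.
have tC k : \sum_(S : {set T} | k \notin S) p S = 1 - t k.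
  by rewrite -p1 [in RHS](bigID (fun S : {set T} => k \in S))/= [in RHS]addrC addrK.
(* [u k] is the marginal law of the indicator of [k \in S]. It dominates [p S], so its factors are
   positive wherever [p] is. *)
pose u k (b : bool) := if b then t k else 1 - t k.
have p_le_u (S : {set T}) k : p S <= u k (k \in S).
  rewrite /u; case: ifPn => kS; rewrite -?tC /t (bigD1 S)//= lerDl;
  exact: sumr_ge0.
have u0 (S : {set T}) k : 0 <= u k (k \in S) by apply: le_trans (p_le_u _ _).
have upos (S : {set T}) k : 0 < p S -> 0 < u k (k \in S).
  by move=> /lt_le_trans; apply.
pose q (S : {set T}) := \prod_k u k (k \in S).
apply: (@le_trans _ _ (\sum_S - (p S * ln (q S)))).
  apply: gibbs => // [S|S pS0|].
  - exact: prodr_ge0.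
  - by apply: prodr_gt0 => k _; exact: upos.
  (* Expanding this product over the subsets shows that [q] has total mass 1. *)
  - suff -> : \sum_S q S = \prod_k (t k + (1 - t k)).
      by rewrite p1 big1// => k _; rewrite subrKC.
    by rewrite bigA_distr; apply: eq_bigr => S _; apply: eq_bigr => k _.
(* The cross entropy equals the sum of the marginal entropies: [ln (q S)] splits over [k] when
   [p S > 0], and both sides vanish when [p S = 0]. For fixed [k], the sets with and without [k]
   then collect the masses [t k] and [1 - t k]. *)
rewrite le_eqVlt; apply/predU1P; left.
transitivity (\sum_S \sum_k - (p S * ln (u k (k \in S)))).
  apply: eq_bigr => S _; have := p0 S; rewrite le_eqVlt => /predU1P[<-|pS0].
    by rewrite mul0r oppr0 big1// => k _; rewrite mul0r oppr0.
  by rewrite ln_prod ?mulr_sumr ?sumrN// => k; exact: upos.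
rewrite exchange_big; apply: eq_bigr => k _.
rewrite sumrN (bigID (fun S : {set T} => k \in S))/= -tC !mulr_suml.
congr (- (_ + _)); apply: eq_bigr => S kS; first by rewrite /u kS.
by rewrite /u (negbTE kS) tC.
Qed.

(** For [t < 1], multiply [ln (1 - t)^-1 <= (1 - t)^-1 - 1] by [1 - t]; at [t = 1] the second term
    vanishes. *)
Lemma binary_entropy_le {R : realType} (t : R) :
  t <= 1 -> - (t * ln t + (1 - t) * ln (1 - t)) <= t - t * ln t.
Proof.
rewrite -subr_ge0 le_eqVlt => /predU1P[t1|t1].
  by rewrite -t1 mul0r addr0 addrC lerDl; lra.
have := ln_le_subr1 (1 - t)^-1; rewrite invr_gt0 => /(_ t1).
move=> /(ler_wpM2l (ltW t1)); rewrite lnV ?posrE//.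
rewrite [_ * (_^-1 - 1)]mulrBr divff ?gt_eqF// mulr1; lra.
Qed.

Section fourier_theory.
Context {R : realType} {n : nat}.
Implicit Types (f g : cube n -> bool) (x y : cube n) (S : {set 'I_n}).

Lemma pm1M (a b : bool) : pm1 R a * pm1 R b = pm1 R (a (+) b).
Proof. by rewrite /pm1 signr_addb. Qed.

(** The sum factors as the product over [i] of [x_i y_i + 1], and a coordinate where [x] and [y]
    differ gives a zero factor. *)
Lemma sum_characterM x y :
  \sum_(S : {set 'I_n}) (\prod_(i in S) pm1 R (x i)) * (\prod_(i in S) pm1 R (y i))
    = 2 ^+ n * (x == y)%:R.
Proof.
transitivity (\prod_(i < n) (pm1 R (x i (+) y i) + 1)).
  rewrite bigA_distr; apply: eq_bigr => S _; rewrite -big_split/= big_mkcond/=.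
  by apply: eq_bigr => i _; rewrite pm1M.
case: eqP => [->|/eqP xy].
  rewrite mulr1 (eq_bigr (fun=> 2)) ?prodr_const ?card_ord// => i _.
  by rewrite addbb.
have [i xyi] : exists i, x i != y i.
  by apply/existsP; apply: contraNT xy => /existsPn h; apply/eqP/ffunP => i;
     apply/eqP; rewrite -[_ == _]negbK h.
rewrite mulr0 (bigD1 i)//= negb_eqb in xyi *.
by rewrite xyi /pm1 expr1 addNr mul0r.
Qed.

(** Once both coefficients are expanded and the sum over [S] is moved inside, [sum_characterM]
    leaves only the diagonal [x = y]. *)
Lemma parseval f g :
  \sum_S fourier R f S * fourier R g S
    = 2 ^- n * \sum_x pm1 R (f x) * pm1 R (g x).
Proof.
have n0 : (2 ^+ n : R) != 0 by rewrite expf_neq0// pnatr_eq0.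
transitivity (2 ^- n * 2 ^- n * \sum_x \sum_y pm1 R (f x) * pm1 R (g y) *
    \sum_(S : {set 'I_n}) (\prod_(i in S) pm1 R (x i)) * (\prod_(i in S) pm1 R (y i))).
  under [in RHS]eq_bigr do under eq_bigr do rewrite mulr_sumr.
  under [in RHS]eq_bigr do rewrite exchange_big.
  rewrite [in RHS]exchange_big mulr_sumr; apply: eq_bigr => S _.
  rewrite /fourier mulrACA; congr (_ * _); rewrite mulr_suml.
  apply: eq_bigr => x _; rewrite mulr_sumr; apply: eq_bigr => y _.
  by rewrite mulrACA.
rewrite -mulrA; congr (_ * _); rewrite mulr_sumr; apply: eq_bigr => x _.
rewrite (bigD1 x)//= sum_characterM [X in _ + X]big1 => [|y yx].
  by rewrite eqxx addr0 mulr1 mulrCA mulVf// mulr1.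
by rewrite sum_characterM eq_sym (negbTE yx) !mulr0.
Qed.

Lemma flipK (k : 'I_n) : involutive (@flip n k).
Proof.
by move=> x; apply/ffunP => i; rewrite !ffunE; case: eqP => // _; rewrite negbK.
Qed.

(** After the substitution of [flip k x] for [x], the character of [S] changes sign exactly when
    [k \in S]. *)
Lemma fourier_flip f (k : 'I_n) S :
  fourier R (fun x => f (flip k x)) S = pm1 R (k \in S) * fourier R f S.
Proof.
rewrite /fourier mulrCA; congr (_ * _).
rewrite (reindex_inj (inv_inj (flipK k))) mulr_sumr.
apply: eq_bigr => x _; rewrite flipK [RHS]mulrCA; congr (_ * _).
have [kS|kS] := boolP (k \in S); last first.
  rewrite mul1r; apply: eq_bigr => i iS; rewrite ffunE.
  by case: eqP => // ik; rewrite ik (negbTE kS) in iS.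
rewrite !(bigD1 k kS)/= mulrA; congr (_ * _).
  by rewrite ffunE eqxx pm1M addTb.
by apply: eq_bigr => i /andP[_ /negbTE ik]; rewrite ffunE ik.
Qed.

Lemma sum_fourier_sqr f : \sum_S fourier R f S ^+ 2 = 1.
Proof.
under eq_bigr do rewrite expr2.
rewrite parseval; under eq_bigr do rewrite pm1M addbb.
rewrite sumr_const card_ffun card_bool card_ord natrX mulVf//.
by rewrite expf_neq0// pnatr_eq0.
Qed.

(* Parseval for f and f \o flip k gives
   \sum_S (-1)^[k \in S] \hat f(S)^2 = 1 - 2 I_k(f). *)
Lemma influence_fourier f (k : 'I_n) :
  influence R f k = \sum_(S : {set 'I_n} | k \in S) fourier R f S ^+ 2.
Proof.
have n0 : (2 ^+ n : R) != 0 by rewrite expf_neq0// pnatr_eq0.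
have flipE : \sum_(S : {set 'I_n}) pm1 R (k \in S) * fourier R f S ^+ 2
    = 1 - 2 * influence R f k.
  transitivity (2 ^- n * \sum_x (1 - 2 * (f x != f (flip k x))%:R) : R).
    under eq_bigr do rewrite expr2 mulrCA -fourier_flip.
    rewrite parseval; congr (_ * _); apply: eq_bigr => x _.
    by rewrite pm1M -negb_eqb; case: (_ == _); rewrite /pm1/=; lra.
  rewrite sumrB sumr_const card_ffun card_bool card_ord natrX mulrBr mulVf//.
  rewrite -mulr_sumr -natr_sum -big_mkcond sum1dep_card /influence /cube_prob.
  by rewrite mulrCA [_ / 2 ^+ n]mulrC.
(* If [a] and [b] are the masses of the sets with and without [k], then [a + b = 1] and
   [b - a = 1 - 2 I_k(f)], hence [a = I_k(f)]. *)
have := sum_fourier_sqr f; rewrite (bigID (fun S => k \in S))/= => sum1.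
move: flipE; rewrite (bigID (fun S => k \in S))/=.
under eq_bigr => S kS do rewrite kS [pm1 _ _]expr1 mulN1r.
under [X in _ + X]eq_bigr => S kS do rewrite (negbTE kS) mul1r.
rewrite sumrN; lra.
Qed.

End fourier_theory.

(* When influence R f k = 0 the product influence R f k * ln _ is 0. *)
Theorem theorem5p2p2 (R : realType) :
  exists c1 c2 : R, 0 < c1 /\ 0 < c2 /\
    forall (n : nat) (f : cube n -> bool), (0 < n)%N ->
      spectral_entropy R f <=
        c1 * total_influence R f
        + c2 * \sum_(k < n) - (influence R f k * ln (influence R f k)).
Proof.
have c0 : 0 < (ln 2)^-1 :> R by rewrite invr_gt0 ln_gt0// ltr1n.
exists (ln 2)^-1, (ln 2)^-1; do 2 split=> //; move=> n f _.
(* Both constants are the factor that converts [log2] into [ln], so it cancels from the two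
   sides. *)
have -> : spectral_entropy R f
    = (ln 2)^-1 * \sum_S fourier R f S ^+ 2 * ln (1 / fourier R f S ^+ 2).
  by rewrite mulr_sumr; apply: eq_bigr => S _; rewrite /log2 mulrA mulrC.
rewrite -mulrDr ler_pM2l// /total_influence -big_split/=.
have p0 S : 0 <= fourier R f S ^+ 2 by exact: sqr_ge0.
have p1 := @sum_fourier_sqr R n f.
apply: le_trans (entropy_subadditive _ p0 p1) _.
apply: ler_sum => k _; rewrite -influence_fourier; apply: binary_entropy_le.
(* The influence is at most 1, as a partial sum of nonnegative terms of total 1. *)
rewrite influence_fourier -p1 [leRHS](bigID (fun S : {set 'I_n} => k \in S))/=.
by rewrite lerDl sumr_ge0.
Qed.
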